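(* Let $\pi:Y\to X$ be a locally split map. A class $\alpha\in H^3(X;\mathbb Z)$ is represented by a bundle gerbe $(L,Y,X)$ (i.e. $\alpha=\mathrm{DD}(L)$) for the given map $\pi$ if and only if $\pi^*\alpha=0\in H^3(Y;\mathbb Z)$.
   Context: All spaces are compactly generated Hausdorff, all maps continuous. $\pi:Y\to X$ is locally split if it is surjective and has continuous sections over the members of some open cover of $X$. Cohomology is Čech cohomology; $H^k(\cdot;\mathbb C^* )\cong H^{k+1}(\cdot;\mathbb Z)$ by the Bockstein isomorphism. $Y^{[k]}$ is the $k$-fold fiber product of $Y$ over $X$, $\pi_j:Y^{[k+1]}\to Y^{[k]}$ omits the $j$th factor ($j=0,\dots,k$). For a line bundle $L\to Y^{[k]}$, $dL=\bigotimes_{j=0}^k\pi_j^*L^{(-1)^j}\to Y^{[k+1]}$, similarly for sections; $d^2L$ is canonically trivial. A bundle gerbe $(L,Y,X)$ is a complex line bundle $L\to Y^{[2]}$ with a trivialization $s$ of $dL\to Y^{[3]}$ such that $ds$ is the canonical trivialization of $d^2L\to Y^{[4]}$. Čech conventions. A cover $\mathcal U$ is an indexed family of open sets covering a space, $\mathrm{Et}(\mathcal U)=\bigsqcup U$; a map of covers is a continuous map $\mathrm{Et}(\mathcal V)\to\mathrm{Et}(\mathcal U)$ taking each member into a specified member. An admissible pair for $\pi$ consists of covers $\mathcal U$ of $X$, $\mathcal V$ of $Y$ and maps of covers $\tilde\pi:\mathrm{Et}(\mathcal V)\to\mathrm{Et}(\mathcal U)$ lifting $\pi$ and $\tilde s:\mathrm{Et}(\mathcal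 U)\to\mathrm{Et}(\mathcal V)$ lifting local sections of $\pi$ with $\tilde\pi\tilde s=\mathrm{Id}$, such that whenever $U_1\cap U_2\neq\emptyset$ there is $V_2\in\mathcal V$ over $U_2$ with $\tilde s_{U_1}(U_1\cap U_2)\subset V_2$. Then $\mathcal V^{[k]}=\mathcal V\times_{\mathcal U}\cdots\times_{\mathcal U}\mathcal V$ covers $Y^{[k]}$, the $\pi_j$ lift, and $d=\sum_j(-1)^j\pi_j^*$ acts on Čech cochains $\check C^\bullet_{\mathcal V^{[k]}}(Y^{[k]};A)$, commuting with the Čech differential $\delta$. Admissible pairs can be taken arbitrarily fine. Dixmier–Douady class: for some admissible pair, $L$ has local nonvanishing sections whose simplicial differential is $s$; the transition cocycle $c(L)\in\check C^1(Y^{[2]};\mathbb C^* )$ satisfies $\delta c(L)=dc(L)=0$, and $\mathrm{DD}(L)\in H^3(X;\mathbb Z)\cong H^2(X;\mathbb C^* )$ is the class of $a\in\check C^2(X;\mathbb C^* )$, where (additive notation) $c(L)=-d\beta$ and $\delta\beta=da=\pi^*a$ for some $\beta\in\check C^1(Y;\mathbb C^* )$. *)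

(* Defs.v *)
From HB Require Import structures.
From mathcomp Require Import all_boot all_order all_algebra.
From mathcomp Require Import complex.
From mathcomp Require Import all_classical all_reals all_analysis.
From Stdlib Require Relation_Operators.

Set Implicit Arguments.
Unset Strict Implicit.
Unset Printing Implicit Defensive.

Import Order.TTheory GRing.Theory Num.Theory.
Import numFieldNormedType.Exports.

Local Open Scope classical_set_scope.
Local Open Scope ring_scope.

Definition Zdisc : Type := discrete_topology int.
HB.instance Definition _ := Topological.copy Zdisc (discrete_topology int).
HB.instance Definition _ := GRing.Zmodule.copy Zdisc int.

Lemma Zdisc_sub_continuous : continuous (fun x : Zdisc * Zdisc => x.1 - x.2).
Proof.
move=> x A /= /nbhs_singleton Ax.
exists ([set x.1], [set x.2]) => /=.
  by split; exact/principal_filterP.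
by move=> [u v] [/= -> ->].
Qed.
HB.instance Definition _ :=
  PreTopologicalNmodule_isTopologicalZmodule.Build Zdisc Zdisc_sub_continuous.

Definition Cplx (R : realType) : numFieldType := R[i]%C.

Section Cstar.
Variable R : realType.

(* The multiplicative group of C with the subspace topology, written
   additively: x + y is the product of complex numbers and - x the inverse. *)
Definition Cstar : Type := {z : Cplx R | z != 0}.
Implicit Types x y : Cstar.

HB.instance Definition _ := Choice.on Cstar.
HB.instance Definition _ :=
  Topological.copy Cstar (initial_topology (fun x : Cstar => val x : Cplx R)).

Definition Cstar_one : Cstar := exist _ 1 (oner_neq0 _).
Definition Cstar_mul x y : Cstar :=
  exist _ (val x * val y) (mulf_neq0 (valP x) (valP y)).
Definition Cstar_inv x : Cstar := exist _ (val x)^-1 (invr_neq0 (valP x)).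

Lemma Cstar_mulA : associative Cstar_mul.
Proof. by move=> x y z; apply: val_inj; exact: mulrA. Qed.
Lemma Cstar_mulC : commutative Cstar_mul.
Proof. by move=> x y; apply: val_inj; exact: mulrC. Qed.
Lemma Cstar_mul1 : left_id Cstar_one Cstar_mul.
Proof. by move=> x; apply: val_inj; exact: mul1r. Qed.
Lemma Cstar_mulV : left_inverse Cstar_one Cstar_inv Cstar_mul.
Proof. by move=> x; apply: val_inj; exact: mulVf (valP x). Qed.
HB.instance Definition _ :=
  GRing.isZmodule.Build Cstar Cstar_mulA Cstar_mulC Cstar_mul1 Cstar_mulV.

Lemma Cstar_val_continuous : continuous (fun x : Cstar => val x : Cplx R).
Proof. exact: initial_continuous. Qed.

Lemma Cstar_sub_continuous : continuous (fun x : Cstar * Cstar => x.1 - x.2).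
Proof.
move=> x.
apply: (@continuous_comp_initial _ _ _ (fun x : Cstar => val x : Cplx R)
  (fun x : Cstar * Cstar => x.1 - x.2)).
move=> {}x; apply: (@continuousM (Cplx R) _ (fun y : Cstar * Cstar => val y.1)
  (fun y : Cstar * Cstar => (val y.2)^-1)).
  apply: continuous_comp; first exact: cvg_fst.
  exact: Cstar_val_continuous.
apply: (@continuousV (Cplx R)); first exact: (valP x.2).
apply: continuous_comp; first exact: cvg_snd.
exact: Cstar_val_continuous.
Qed.
HB.instance Definition _ :=
  PreTopologicalNmodule_isTopologicalZmodule.Build Cstar Cstar_sub_continuous.

End Cstar.

(* z |-> exp (2 pi i z) *)
Definition cexp2pi (R : realType) (z : R[i]) : R[i] :=
  let: Complex x y := z in
  Complex (expR (- (2 * pi * y)) * cos (2 * pi * x))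
          (expR (- (2 * pi * y)) * sin (2 * pi * x)).

Definition compactly_generated_hausdorff (X : topologicalType) :=
  hausdorff_space X /\
  forall A : set X,
    (forall K : set X, compact K -> closed (A `&` K)) -> closed A.

Definition kification (X : topologicalType) : Type := X.

Section Kification.
Variable X : topologicalType.

HB.instance Definition _ := Choice.on (kification X).

Definition kopen (U : set (kification X)) :=
  forall K : set X, compact K -> exists2 V : set X, open V & U `&` K = V `&` K.

Lemma kopenT : kopen setT.
Proof. by move=> K _; exists setT => //; exact: openT. Qed.

Lemma kopenI : setI_closed kopen.
Proof.
move=> U U' hU hU' K cK; have [V oV UV] := hU K cK; have [V' oV' UV'] := hU' K cK.
exists (V `&` V'); first exact: openI.
by rewrite setIIl UV UV' -setIIl.
Qed.

Lemma kopen_bigU (I : Type) (f : I -> set (kification X)) :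
  (forall i, kopen (f i)) -> kopen (\bigcup_i f i).
Proof.
move=> hf K cK.
exists (\bigcup_(V in [set V : set X | open V /\ exists i, f i `&` K = V `&` K]) V).
  by apply: bigcup_open => V [].
apply/seteqP; split=> x [].
  move=> [i _ fix_] Kx; have [V oV fV] := hf i K cK; split=> //.
  exists V; first by split=> //; exists i.
  by have [] : (V `&` K) x by rewrite -fV.
move=> [V [oV [i fV]] Vx] Kx; split=> //; exists i => //.
by have [] : (f i `&` K) x by rewrite fV.
Qed.

HB.instance Definition _ :=
  isOpenTopological.Build (kification X) kopenT kopenI kopen_bigU.

Lemma kification_openE (U : set (kification X)) : open U = kopen U.
Proof. by []. Qed.
End Kification.

Lemma kification_continuous (X X' : topologicalType) (f : X -> X') :
  continuous f -> continuous (f : kification X -> kification X').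
Proof.
move=> cf; apply/continuousP => U; rewrite !kification_openE => hU K cK.
have cfK : compact (f @` K).
  by apply: continuous_compact => //; exact: continuous_subspaceT.
have [V oV UV] := hU _ cfK.
exists (f @^-1` V); first by move/continuousP: cf; apply.
apply/seteqP; split=> x [Ux Kx]; split=> //.
  by have [] : (V `&` f @` K) (f x) by rewrite -UV; split=> //; exists x.
by have [] : (U `&` f @` K) (f x) by rewrite UV; split=> //; exists x.
Qed.

(* The k-fold fibre product of the set A over B: k-tuples in A with the same
   image in B. *)
Definition fibtuple (A B : Type) (f : A -> B) (k : nat) : Type :=
  {t : 'I_k -> A | forall i j, f (t i) = f (t j)}.

Definition omit (A B : Type) (f : A -> B) k (j : 'I_k.+1)
    (t : fibtuple f k.+1) : fibtuple f k :=
  @exist _ (fun u => forall i i', f (u i) = f (u i')) (fun i => sval t (lift j i))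
    (fun i i' => proj2_sig t (lift j i) (lift j i')).

(* The k-fold fibre product of Y over X in compactly generated spaces: the
   k-ification of the subspace of the product space. *)
Definition fibset (X Y : topologicalType) (p : Y -> X) (k : nat) :
    set {ptws 'I_k -> Y} :=
  [set y | forall i j, p (y i) = p (y j)].
Arguments fibset {X Y} p k.

Definition fibprod (X Y : topologicalType) (p : Y -> X) (k : nat) : Type :=
  kification (set_type (fibset p k)).
HB.instance Definition _ X Y p k := Topological.on (@fibprod X Y p k).

Section FibprodMaps.
Variables (X Y : topologicalType) (p : Y -> X).

Definition fpcoord k (i : 'I_k) (y : fibprod p k) : Y := set_val y i.

Lemma fpomit_subproof k (j : 'I_k.+1) (y : fibprod p k.+1) :
  (fun i => fpcoord (lift j i) y) \in fibset p k.
Proof. by apply/mem_set => i i'; have /set_mem := valP y; apply. Qed.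

Definition fpomit k (j : 'I_k.+1) (y : fibprod p k.+1) : fibprod p k :=
  @exist _ (fun u => u \in fibset p k) _ (fpomit_subproof j y).

Lemma sub_fpcoord_continuous k (i : 'I_k) :
  continuous (fun y : set_type (fibset p k) => set_val y i).
Proof.
move=> y; apply: (@continuous_comp _ _ _ set_val (fun t : {ptws 'I_k -> Y} => t i)).
  exact: initial_continuous.
exact: proj_continuous.
Qed.

Lemma fpcoord_continuous k (i : 'I_k) : continuous (@fpcoord k i).
Proof.
apply/continuousP => U oU; rewrite kification_openE => K _.
exists (@fpcoord k i @^-1` U) => //.
by move/continuousP: (@sub_fpcoord_continuous k i); apply.
Qed.

Lemma fpomit_continuous k (j : 'I_k.+1) : continuous (@fpomit k j).
Proof.
apply: kification_continuous => y.
apply: continuous_comp_initial => {}y.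
apply/cvg_sup; first by apply: fmap_filter; exact: nbhs_filter.
move=> i; apply: (@continuous_comp_initial _ _ _ (fun f => f i)) => {}y.
exact: sub_fpcoord_continuous.
Qed.
End FibprodMaps.

Section Lines.
Variable K : fieldType.
Implicit Types V W : vectType K.

Definition dual_space V : vectType K := 'Hom(V, K^o).

(* V (x) W for finite-dimensional V, realised as the linear maps from the dual
   of V to W; tensorv v w is the simple tensor v (x) w. *)
Definition tensor V W : vectType K := 'Hom(dual_space V, W).

(* For V one-dimensional and v <> 0, this is the element of the dual
   taking the value 1 at v. *)
Definition dualv V (v : V) : dual_space V := linfun (coord [tuple v] ord0 : V -> K^o).

Definition eval_scale V W (v : V) (w : W) (phi : dual_space V) : W :=
  (phi v : K) *: w.
Lemma eval_scale_linear V W v w : linear (@eval_scale V W v w).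
Proof.
by move=> a f g; rewrite /eval_scale add_lfunE scale_lfunE scalerDl scalerA.
Qed.
HB.instance Definition _ V W (v : V) (w : W) :=
  GRing.isLinear.Build K (dual_space V) W _ _ (eval_scale_linear v w).
Definition tensorv V W (v : V) (w : W) : tensor V W := linfun (eval_scale v w).

Definition signV (b : bool) V : vectType K := if b then dual_space V else V.
Definition signv (b : bool) V : V -> signV b V :=
  if b return V -> signV b V then @dualv V else id.

(* V 0 (x) (V 1 (x) ( ... (x) K)) *)
Fixpoint bigtensor n : ('I_n -> vectType K) -> vectType K :=
  match n return ('I_n -> vectType K) -> vectType K with
  | 0 => fun=> K^o
  | m.+1 => fun E => tensor (E ord0) (bigtensor (fun i => E (lift ord0 i)))
  end.

Fixpoint bigtensorv n :
    forall E : 'I_n -> vectType K, (forall i, E i) -> bigtensor E :=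
  match n return
    forall E : 'I_n -> vectType K, (forall i, E i) -> bigtensor E with
  | 0 => fun E v => (1 : K^o)
  | m.+1 => fun E v => tensorv (v ord0) (bigtensorv (fun i => v (lift ord0 i)))
  end.

Lemma coord_line V (v w : V) : dim V = 1%N -> v != 0 ->
  w = coord [tuple v] ord0 w *: v.
Proof.
move=> dV vn0.
have wv : w \in <<[tuple v]>>%VS.
  suff -> : <<[tuple v]>>%VS = fullv by exact: memvf.
  apply/eqP; rewrite eqEdim subvf /= dimvf dV span_seq1 dim_vline vn0.
  by [].
by rewrite {1}(coord_span wv) big_ord1.
Qed.

Lemma coord_self V (v : V) : v != 0 -> coord [tuple v] ord0 v = 1.
Proof.
move=> vn0; have fv : free [tuple v] by rewrite seq1_free.
by rewrite -[X in coord _ _ X]/([tuple v]`_(@ord0 0)) (coord_free ord0 ord0 fv) eqxx.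
Qed.

Lemma dualv_self V (v : V) : v != 0 -> dualv v v = 1.
Proof. by move=> vn0; rewrite /dualv lfunE /= coord_self. Qed.

Lemma dim_dual V : dim V = 1%N -> dim (dual_space V) = 1%N.
Proof. by move=> dV; rewrite [LHS]/(dim V * _)%N dV. Qed.

Lemma dim_tensor V W : dim V = 1%N -> dim W = 1%N -> dim (tensor V W) = 1%N.
Proof. by move=> dV dW; rewrite [LHS]/((dim V * _) * dim W)%N dV dW. Qed.

Lemma dualv_neq0 V (v : V) : v != 0 -> dualv v != 0.
Proof.
move=> vn0; apply/eqP => /(congr1 (fun f : dual_space V => f v)).
by rewrite dualv_self // zero_lfunE => /eqP; rewrite oner_eq0.
Qed.

Lemma dualvZ V (v : V) a : dim V = 1%N -> v != 0 -> a != 0 ->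
  dualv (a *: v) = a^-1 *: dualv v.
Proof.
move=> dV vn0 an0; have avn0 : a *: v != 0 by rewrite scaler_eq0 negb_or an0.
apply/lfunP => w; rewrite scale_lfunE (coord_line w dV vn0).
set c := coord _ _ _; rewrite linearZ [in RHS]linearZ /= dualv_self //.
have /(congr1 ( *%R a^-1)) := dualv_self avn0.
rewrite linearZ /= -[_ *: _]/(_ * _) mulKf // mulr1 => ->.
by rewrite -[LHS]/(c * a^-1) -[RHS]/(a^-1 * (c * 1)) mulr1 mulrC.
Qed.

Lemma tensorvE V W (v : V) (w : W) phi : tensorv v w phi = (phi v : K) *: w.
Proof. by rewrite lfunE. Qed.

Lemma tensorv_neq0 V W (v : V) (w : W) : v != 0 -> w != 0 -> tensorv v w != 0.
Proof.
move=> vn0 wn0; apply/eqP => /(congr1 (fun f : tensor V W => f (dualv v))).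
by rewrite tensorvE dualv_self // scale1r zero_lfunE => /eqP; apply/negP.
Qed.

Lemma tensorvZ V W (v : V) (w : W) a b :
  tensorv (a *: v) (b *: w) = (a * b) *: tensorv v w.
Proof.
apply/lfunP => phi; rewrite scale_lfunE !tensorvE !scalerA.
have -> : phi (a *: v) = a * phi v by rewrite [LHS]linearZ.
by rewrite mulrAC.
Qed.

Lemma dim_signV b V : dim V = 1%N -> dim (signV b V) = 1%N.
Proof. by case: b => //; exact: dim_dual. Qed.

Lemma signv_neq0 b V (v : V) : v != 0 -> signv b v != 0.
Proof. by case: b => //; exact: dualv_neq0. Qed.

Lemma signvZ b V (v : V) a : dim V = 1%N -> v != 0 -> a != 0 ->
  signv b (a *: v) = (if b then a^-1 else a) *: signv b v.
Proof. by case: b => // dV vn0 an0; exact: dualvZ. Qed.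

Lemma dim_bigtensor n (V : 'I_n -> vectType K) :
  (forall i, dim (V i) = 1%N) -> dim (bigtensor V) = 1%N.
Proof. by elim: n V => [//|n IH] V dV; apply: dim_tensor => //; exact: IH. Qed.

Lemma bigtensorv_neq0 n (V : 'I_n -> vectType K) (v : forall i, V i) :
  (forall i, v i != 0) -> bigtensorv v != 0.
Proof.
elim: n V v => [|n IH] V v vn0; first exact: oner_neq0.
by apply: tensorv_neq0 => //; exact: IH.
Qed.

Lemma bigtensorvZ n (V : 'I_n -> vectType K) (v : forall i, V i) (a : 'I_n -> K) :
  bigtensorv (fun i => a i *: v i) = (\prod_(i < n) a i) *: bigtensorv v.
Proof.
elim: n V v a => [|n IH] V v a; first by rewrite big_ord0 scale1r.
by rewrite /= IH tensorvZ big_ord_recl.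
Qed.

End Lines.

Lemma continuous_pair (S T U : topologicalType) (f : S -> T) (g : S -> U) x :
  {for x, continuous f} -> {for x, continuous g} ->
  {for x, continuous (fun y => (f y, g y))}.
Proof. by move=> cf cg; exact: (cvg_pair cf cg). Qed.

Section LineBundle.
Variable R : realType.
Local Notation C := (Cplx R).

(* Given a local section s over U, the preimage of W under
   U * C -> E, (b, z) |-> z * s b, where E is the union of the fibres. *)
Definition chart (B : topologicalType) (F : B -> vectType C) (U : set B)
    (s : forall b, F b) (W : set {b : B & F b}) : set (B * C) :=
  [set bz | U bz.1 /\ W (existT _ bz.1 (bz.2 *: s bz.1))].

(* s is nowhere zero on the open set U and (b, z) |-> z * s b is a
   homeomorphism from U * C onto the part of E over U, for the topology on E
   whose open sets are given by op. *)
Definition local_frame (B : topologicalType) (F : B -> vectType C)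
    (op : set (set {b : B & F b})) (U : set B) (s : forall b, F b) : Prop :=
  [/\ open U,
      forall b, U b -> s b != 0 &
      forall W : set {b : B & F b}, W `<=` [set e | U (projT1 e)] ->
        (op W <-> open (chart U s W))].

(* The topology of the total space is given by its open sets. The product with C
   needs no k-ification because C is locally compact. *)
Record line_bundle (B : topologicalType) := LineBundle {
  fiber : B -> vectType C ;
  fiber_dim : forall b, dim (fiber b) = 1%N ;
  total_open : set (set {b : B & fiber b}) ;
  total_openT : total_open setT ;
  total_openI : setI_closed total_open ;
  total_open_bigU : forall (I : Type) (f : I -> set {b : B & fiber b}),
    (forall i, total_open (f i)) -> total_open (\bigcup_i f i) ;
  locally_trivial : forall b, exists2 U : set B, U b &
    exists s : forall b, fiber b, local_frame total_open U s }.

Definition total_space (B : topologicalType) (L : line_bundle B) : Type :=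
  {b : B & fiber L b}.
HB.instance Definition _ B (L : line_bundle B) := Choice.on (total_space L).
HB.instance Definition _ B (L : line_bundle B) :=
  isOpenTopological.Build (total_space L)
    (total_openT L) (@total_openI _ L) (@total_open_bigU _ L).

Lemma total_space_openE B (L : line_bundle B) (W : set (total_space L)) :
  open W = total_open W.
Proof. by []. Qed.

Definition lsection (B : topologicalType) (L : line_bundle B) : Type :=
  forall b, fiber L b.

Definition continuous_section_on (B : topologicalType) (L : line_bundle B)
    (U : set B) (s : lsection L) : Prop :=
  forall b, U b -> {for b, continuous (fun b => existT _ b (s b) : total_space L)}.

Definition nonvanishing_on (B : topologicalType) (L : line_bundle B)
    (U : set B) (s : lsection L) : Prop := forall b, U b -> s b != 0.

Section OfFrames.
Variables (B : topologicalType) (F : B -> vectType C).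
Hypothesis dimF : forall b, dim (F b) = 1%N.
Variable Phi : set (set B * (forall b, F b)).
Hypothesis Phi_open : forall u, Phi u -> open u.1.
Hypothesis Phi_neq0 : forall u, Phi u -> forall b, u.1 b -> u.2 b != 0.
Hypothesis Phi_cover : forall b, exists2 u, Phi u & u.1 b.
Hypothesis Phi_trans : forall u v, Phi u -> Phi v -> exists g : B -> C,
  forall b, u.1 b -> v.1 b ->
    {for b, continuous g} /\ v.2 b = g b *: u.2 b.

Definition frame_open (W : set {b : B & F b}) : Prop :=
  forall u, Phi u -> open (chart u.1 u.2 W).

Lemma cylinder_open (U : set B) : open U -> open [set bz : B * C | U bz.1].
Proof. by move=> oU; apply: (@open_comp _ _ fst) => // x _; exact: cvg_fst. Qed.

Lemma frame_openT : frame_open setT.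
Proof.
move=> u Pu; rewrite /chart (_ : [set _ | _] = [set bz | u.1 bz.1]).
  exact: cylinder_open (Phi_open Pu).
by apply/seteqP; split=> bz //= -[].
Qed.

Lemma frame_openI : setI_closed frame_open.
Proof.
move=> W W' oW oW' u Pu.
rewrite (_ : chart _ _ _ = chart u.1 u.2 W `&` chart u.1 u.2 W').
  by apply: openI; [exact: oW | exact: oW'].
by apply/seteqP; split=> bz /= [] => [? []|[? ?] []].
Qed.

Lemma frame_open_bigU (I : Type) (f : I -> set {b : B & F b}) :
  (forall i, frame_open (f i)) -> frame_open (\bigcup_i f i).
Proof.
move=> of_ u Pu.
rewrite (_ : chart _ _ _ = \bigcup_i chart u.1 u.2 (f i)).
  by apply: bigcup_open => i _; exact: of_.
apply/seteqP; split=> bz /=.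
  by move=> [Ub [i _ fi]]; exists i.
by move=> [i _ [Ub fi]]; split=> //; exists i.
Qed.

Lemma frame_local_frame u : Phi u -> local_frame frame_open u.1 u.2.
Proof.
move=> Pu; split; [exact: Phi_open|exact: Phi_neq0|move=> W WU; split; first exact].
move=> oW v Pv; have [g hg] := Phi_trans Pu Pv.
have oUV : open (u.1 `&` v.1) by apply: openI; exact: Phi_open.
pose m (bz : B * C) : B * C := (bz.1, bz.2 * g bz.1).
have -> : chart v.1 v.2 W =
    [set bz | (u.1 `&` v.1) bz.1] `&` m @^-1` (chart u.1 u.2 W).
  apply/seteqP; split=> -[b z] /=.
    move=> [vb Wb]; have ub := WU _ Wb; split=> //.
    by split=> //=; rewrite -scalerA -(hg _ ub vb).2.
  by move=> [[ub vb] [_]] /=; rewrite -scalerA -(hg _ ub vb).2.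
rewrite openE => -[b z] [[/= ub vb] mbz].
have cm : {for (b, z), continuous m}.
  refine (@continuous_pair _ B C fst (fun bz : B * C => bz.2 * g bz.1) _ _ _).
    exact: cvg_fst.
  apply: (@continuousM C _ snd (g \o fst)); first exact: cvg_snd.
  apply: continuous_comp; first exact: cvg_fst.
  exact: (hg _ ub vb).1.
apply: filterI.
  by apply: open_nbhs_nbhs; split=> //; exact: (cylinder_open oUV).
by apply: cm; apply: open_nbhs_nbhs; split.
Qed.

Lemma frame_locally_trivial b : exists2 U : set B, U b &
  exists s : forall b, F b, local_frame frame_open U s.
Proof.
have [u Pu ub] := Phi_cover b.
by exists u.1 => //; exists u.2; exact: frame_local_frame.
Qed.

Definition bundle_of_frames : line_bundle B :=
  LineBundle dimF frame_openT frame_openI frame_open_bigU frame_locally_trivial.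
End OfFrames.

Definition frames (B : topologicalType) (L : line_bundle B) :
    set (set B * lsection L) :=
  [set u | local_frame (@total_open _ L) u.1 u.2].
Arguments frames {B} L.

Lemma frames_trans (B : topologicalType) (L : line_bundle B) u v :
  frames L u -> frames L v -> exists g : B -> C,
  forall b, u.1 b -> v.1 b ->
    {for b, continuous g} /\ v.2 b = g b *: u.2 b.
Proof.
move=> [uo un0 uW] [vo vn0 vW].
pose g b : C := coord [tuple u.2 b] ord0 (v.2 b).
have gE b : u.1 b -> v.2 b = g b *: u.2 b.
  by move=> ub; apply: coord_line; [exact: fiber_dim|exact: un0].
exists g; move=> b ub vb; split; last exact: gE.
move=> A nA.
have [Z [oO Og] OA] : exists2 Z, open_nbhs (g b) Z & Z `<=` A by move: nA; rewrite nbhsE.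
pose W : set {b : B & fiber L b} := [set e | (u.1 `&` v.1) (projT1 e) /\
  Z (coord [tuple u.2 (projT1 e)] ord0 (projT2 e))].
have ouv : open (u.1 `&` v.1) by exact: openI.
have oW : total_open W.
  apply/(uW W); first by move=> e [[]].
  rewrite (_ : chart _ _ _ = [set bz | (u.1 `&` v.1) bz.1] `&` snd @^-1` Z).
    apply: openI; first exact: (cylinder_open ouv).
    by apply: open_comp => // x _; exact: cvg_snd.
  apply/seteqP; split=> -[c z] /=.
    move=> [uc [ucvc]] /=; rewrite linearZ /= coord_self ?un0 //.
    by rewrite mulr1.
  move=> [[uc vc] Oz]; split=> //; split=> //=.
  by rewrite linearZ /= coord_self ?un0 // mulr1.
have /vW[/(_ oW) ovW _] : W `<=` [set e | v.1 (projT1 e)] by move=> e [[]].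
 have : nbhs (b, 1 : C) (chart v.1 v.2 W).
  apply: open_nbhs_nbhs; split=> //; split=> //; split=> //=.
  by rewrite scale1r.
have cp : {for b, continuous (fun c : B => (c, 1 : C))}.
  refine (@continuous_pair B B C id (fun=> 1) _ _ _); first exact: cvg_id.
  exact: cvg_cst.
move=> /cp /= nb; apply: (@filterS _ (nbhs b) _ _ _ _ nb); move=> c [_ [_]] /=.
by rewrite scale1r => /OA.
Qed.

Lemma frames_cover (B : topologicalType) (L : line_bundle B) b :
  exists2 u, frames L u & u.1 b.
Proof. by have [U Ub [s Us]] := locally_trivial L b; exists (U, s). Qed.

End LineBundle.

Arguments frames {R B} L.

Lemma open_forall (I : finType) (X : topologicalType) (U : I -> set X) :
  (forall i, open (U i)) -> open [set x | forall i, U i x].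
Proof.
move=> oU; rewrite openE => x Ux; apply: filter_forall => i.
by apply: open_nbhs_nbhs; split.
Qed.

Section BundleOperations.
Variable R : realType.
Local Notation C := (Cplx R).

Section Pullback.
Variables (B B' : topologicalType) (f : B' -> B) (cf : continuous f).
Variable L : line_bundle R B.

Definition pullback_frames : set (set B' * (forall b, fiber L (f b))) :=
  [set u | exists2 v, frames L v & u = (f @^-1` v.1, fun b => v.2 (f b))].

Lemma pullback_frames_open u : pullback_frames u -> open u.1.
Proof. by move=> [v [ov _ _] ->] /=; move/continuousP: cf; apply. Qed.

Lemma pullback_frames_neq0 u : pullback_frames u ->
  forall b, u.1 b -> u.2 b != 0.
Proof. by move=> [v [_ vn0 _] ->] b /= vb; exact: vn0. Qed.

Lemma pullback_frames_cover b : exists2 u, pullback_frames u & u.1 b.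
Proof.
have [v Lv vb] := frames_cover L (f b).
by exists (f @^-1` v.1, fun b => v.2 (f b)) => //; exists v.
Qed.

Lemma pullback_frames_trans u v : pullback_frames u -> pullback_frames v ->
  exists g : B' -> C, forall b, u.1 b -> v.1 b ->
    {for b, continuous g} /\ v.2 b = g b *: u.2 b.
Proof.
move=> [u' Lu ->] [v' Lv ->]; have [g hg] := frames_trans Lu Lv.
exists (g \o f) => b /= ub vb; have [cg vE] := hg _ ub vb; split=> //.
by apply: continuous_comp; [exact: cf|exact: cg].
Qed.

Definition pullback : line_bundle R B' :=
  bundle_of_frames (fun b => fiber_dim L (f b)) pullback_frames_open
    pullback_frames_neq0 pullback_frames_cover pullback_frames_trans.
End Pullback.

Section SignBundle.
Variables (B : topologicalType) (e : bool) (L : line_bundle R B).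

Definition sign_frames : set (set B * (forall b, signV e (fiber L b))) :=
  [set u | exists2 v, frames L v & u = (v.1, fun b => signv e (v.2 b))].

Lemma sign_frames_open u : sign_frames u -> open u.1.
Proof. by move=> [v [ov _ _] ->]. Qed.

Lemma sign_frames_neq0 u : sign_frames u -> forall b, u.1 b -> u.2 b != 0.
Proof. by move=> [v [_ vn0 _] ->] b /= vb; apply: signv_neq0; exact: vn0. Qed.

Lemma sign_frames_cover b : exists2 u, sign_frames u & u.1 b.
Proof.
have [v Lv vb] := frames_cover L b.
by exists (v.1, fun b => signv e (v.2 b)) => //; exists v.
Qed.

Lemma sign_frames_trans u v : sign_frames u -> sign_frames v ->
  exists g : B -> C, forall b, u.1 b -> v.1 b ->
    {for b, continuous g} /\ v.2 b = g b *: u.2 b.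
Proof.
move=> [u' Lu ->] [v' Lv ->]; have [g hg] := frames_trans Lu Lv.
exists (fun b => if e then (g b)^-1 else g b) => b /= ub vb.
have [cg vE] := hg _ ub vb.
have un0 : u'.2 b != 0 by case: Lu => _ + _; apply.
have gn0 : g b != 0.
  have : v'.2 b != 0 by case: Lv => _ + _; apply.
  by rewrite vE scaler_eq0 negb_or => /andP[].
split; last by rewrite vE signvZ //; exact: fiber_dim.
case: (e); last exact: cg.
exact: (@continuousV C _ g b gn0 cg).
Qed.

Definition sign_bundle : line_bundle R B :=
  bundle_of_frames (fun b => dim_signV e (fiber_dim L b)) sign_frames_open
    sign_frames_neq0 sign_frames_cover sign_frames_trans.
End SignBundle.

Section BigTensor.
Variables (B : topologicalType) (n : nat) (L : 'I_n -> line_bundle R B).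

Definition bigtensor_frames :
    set (set B * (forall b, bigtensor (fun i => fiber (L i) b))) :=
  [set u | exists2 v : forall i, set B * lsection (L i),
    forall i, frames (L i) (v i) &
    u = ([set b | forall i, (v i).1 b], fun b => bigtensorv (fun i => (v i).2 b))].

Lemma bigtensor_frames_open u : bigtensor_frames u -> open u.1.
Proof. by move=> [v Lv ->]; apply: open_forall => i; have [] := Lv i. Qed.

Lemma bigtensor_frames_neq0 u : bigtensor_frames u ->
  forall b, u.1 b -> u.2 b != 0.
Proof.
move=> [v Lv ->] b /= vb; apply: bigtensorv_neq0 => i.
have [_ vn0 _] := Lv i; exact: vn0 (vb i).
Qed.

Lemma bigtensor_frames_cover b : exists2 u, bigtensor_frames u & u.1 b.
Proof.
pose v i := s2val (cid2 (frames_cover (L i) b)).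
have Lv i : frames (L i) (v i) by exact: s2valP.
have vb i : (v i).1 b by exact: (s2valP' (cid2 (frames_cover (L i) b))).
exists ([set b | forall i, (v i).1 b], fun b => bigtensorv (fun i => (v i).2 b)) => //.
by exists v.
Qed.

Lemma bigtensor_frames_trans u v : bigtensor_frames u -> bigtensor_frames v ->
  exists g : B -> C, forall b, u.1 b -> v.1 b ->
    {for b, continuous g} /\ v.2 b = g b *: u.2 b.
Proof.
move=> [u' Lu ->] [v' Lv ->].
have [g hg] := choice (fun i => frames_trans (Lu i) (Lv i)).
exists (fun b => \prod_(i < n) g i b) => b /= ub vb; split.
  apply: cvg_big => [|i _]; last exact: (hg i _ (ub i) (vb i)).1.
  exact: mul_continuous.
rewrite -bigtensorvZ; congr bigtensorv; apply: functional_extensionality_dep => i.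
exact: (hg i _ (ub i) (vb i)).2.
Qed.

Definition bigtensor_bundle : line_bundle R B :=
  bundle_of_frames (fun b => dim_bigtensor (fun i => fiber_dim (L i) b))
    bigtensor_frames_open bigtensor_frames_neq0 bigtensor_frames_cover
    bigtensor_frames_trans.
End BigTensor.

Section Simplicial.
Variables (X Y : topologicalType) (p : Y -> X) (k : nat).
Variable L : line_bundle R (fibprod p k).

Definition dbundle : line_bundle R (fibprod p k.+1) :=
  bigtensor_bundle (fun j : 'I_k.+1 =>
    sign_bundle (odd j) (pullback (@fpomit_continuous _ _ p k j) L)).

Definition dsection (s : lsection L) : lsection dbundle :=
  fun y => bigtensorv (fun j : 'I_k.+1 => signv (odd j) (s (fpomit j y))).
End Simplicial.

End BundleOperations.

Record open_cover (X : topologicalType) := OpenCover {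
  cover_index : Type ;
  member :> cover_index -> set X ;
  member_open : forall i, open (member i) ;
  member_cover : forall x, exists i, member i x }.
Arguments member {X} o i _.
Arguments member_open {X} o i.
Arguments member_cover {X} o x.

Definition trivial_cover (X : topologicalType) : open_cover X :=
  @OpenCover X unit (fun=> setT) (fun=> openT) (fun=> ex_intro _ tt I).

Definition pullback_cover (X Y : topologicalType) (f : Y -> X)
    (cf : continuous f) (U : open_cover X) : open_cover Y :=
  @OpenCover Y (cover_index U) (fun i => f @^-1` U i)
    (fun i => (continuousP f).1 cf _ (member_open U i))
    (fun y => member_cover U (f y)).

Section Cochains.
Variables (X : topologicalType) (A : topologicalZmodType).
Implicit Types U V : open_cover X.

(* A p-cochain assigns to each (p+1)-tuple of indices a function which is only
   meaningful on the intersection of the corresponding members. *)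
Definition cochain U (p : nat) : Type := ('I_p.+1 -> cover_index U) -> X -> A.

Definition cap U (p : nat) (t : 'I_p.+1 -> cover_index U) : set X :=
  [set x | forall l, U (t l) x].

Definition is_cochain U p (c : cochain U p) : Prop :=
  forall t x, cap t x -> {for x, continuous (c t)}.

Definition eq_cochain U p (c c' : cochain U p) : Prop :=
  forall t x, cap t x -> c t x = c' t x.

Definition cochain0 U p : cochain U p := fun _ _ => 0.
Arguments cochain0 U p _ _ : clear implicits.

Definition addc U p (c c' : cochain U p) : cochain U p :=
  fun t x => c t x + c' t x.

Definition oppc U p (c : cochain U p) : cochain U p := fun t x => - c t x.

Definition delta U p (c : cochain U p) : cochain U p.+1 :=
  fun t x => \sum_(j < p.+2) c (fun l => t (lift j l)) x *~ (-1) ^+ j.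

Record cocycle U p := Cocycle {
  cocycle_val :> cochain U p ;
  cocycle_is_cochain : is_cochain cocycle_val ;
  cocycle_closed : eq_cochain (delta cocycle_val) (cochain0 U p.+1) }.

Definition is_coboundary U p : cochain U p -> Prop :=
  match p return cochain U p -> Prop with
  | 0 => fun c => eq_cochain c (cochain0 U 0)
  | q.+1 => fun c =>
      exists2 b : cochain U q, is_cochain b & eq_cochain c (delta b)
  end.

Definition refines V U (r : cover_index V -> cover_index U) : Prop :=
  forall j, V j `<=` U (r j).

Definition restrictc U V (r : cover_index V -> cover_index U) p
  (c : cochain U p) : cochain V p := fun t x => c (fun l => r (t l)) x.

Definition cocycle_on p : Type := {U : open_cover X & cocycle U p}.

Definition cohom_step p (c c' : cocycle_on p) : Prop :=
  exists2 r : cover_index (projT1 c') -> cover_index (projT1 c), refines r &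
    is_coboundary (addc (projT2 c') (oppc (restrictc r (projT2 c)))).

(* The equivalence relation generated by passing to a refinement and adding a
   coboundary; its quotient is the colimit over covers. *)
Definition cohomologous p : cocycle_on p -> cocycle_on p -> Prop :=
  Relation_Operators.clos_refl_sym_trans _ (@cohom_step p).

Record cech p := Cech {
  cech_mem : cocycle_on p -> Prop ;
  cech_memP : exists c, cech_mem = cohomologous c }.

Definition cech_class_on p (c : cocycle_on p) : cech p :=
  Cech (ex_intro _ c erefl).

Definition cech_class U p (c : cocycle U p) : cech p :=
  cech_class_on (existT _ U c).

Lemma cochain0_is_cochain U p : is_cochain (cochain0 U p).
Proof. by move=> t x _; exact: cst_continuous. Qed.

Lemma cochain0_closed U p : eq_cochain (delta (cochain0 U p)) (cochain0 U p.+1).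
Proof. by move=> t x _; apply: big1 => j _; rewrite mul0rz. Qed.

Definition cocycle0 U p : cocycle U p :=
  Cocycle (@cochain0_is_cochain U p) (@cochain0_closed U p).

Definition cech0 p : cech p := cech_class (cocycle0 (trivial_cover X) p).

Lemma cech_class_onP p (c c' : cocycle_on p) :
  cech_class_on c = cech_class_on c' <-> cohomologous c c'.
Proof.
split=> [/(congr1 (@cech_mem p)) /= -> | cc'].
  exact: Relation_Operators.rst_refl.
suff E : cohomologous c = cohomologous c'.
  rewrite /cech_class_on; move: (ex_intro _ c _) (ex_intro _ c' _).
  by rewrite E => h h'; congr Cech; exact: Prop_irrelevance.
apply: functional_extensionality_dep => d; apply: propositional_extensionality.
split; apply: Relation_Operators.rst_trans.
  exact: Relation_Operators.rst_sym.
exact: cc'.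
Qed.

End Cochains.

Arguments cochain0 {X} A U p _ _.
Arguments cech0 {X} A p.

Section Pullback.
Variables (X Y : topologicalType) (A : topologicalZmodType).
Variables (f : Y -> X) (cf : continuous f).

Section PullCochain.
Variables (U : open_cover X) (p : nat) (c : cocycle A U p).

Definition pullc : cochain A (pullback_cover cf U) p := fun t y => cocycle_val c t (f y).

Lemma pullc_is_cochain : is_cochain pullc.
Proof.
move=> t y ty; apply: continuous_comp; first exact: cf.
exact: cocycle_is_cochain.
Qed.

Lemma pullc_closed : eq_cochain (delta pullc) (cochain0 A _ p.+1).
Proof. by move=> t y ty; exact: (cocycle_closed c). Qed.

Definition pull_cocycle : cocycle A (pullback_cover cf U) p :=
  Cocycle pullc_is_cochain pullc_closed.
End PullCochain.

Definition pull_on p (c : cocycle_on X A p) : cocycle_on Y A p :=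
  existT _ _ (pull_cocycle (projT2 c)).

Lemma pull_on_cohomologous p (c c' : cocycle_on X A p) :
  cohomologous c c' -> cohomologous (pull_on c) (pull_on c').
Proof.
elim=> {c c'} [c c' [r rr cb]|c|c c' _|c c' c'' _ + _].
- apply: Relation_Operators.rst_step; exists r; first by move=> j y; exact: rr.
  case: p c c' r rr cb => [|p] c c' r rr /=.
    by move=> E t y ty; exact: E.
  move=> [b cb E]; exists (fun t y => b t (f y)).
    by move=> t y ty; apply: continuous_comp; [exact: cf|exact: cb].
  by move=> t y ty; exact: E.
- exact: Relation_Operators.rst_refl.
- exact: Relation_Operators.rst_sym.
- exact: Relation_Operators.rst_trans.
Qed.

Definition cech_pullback p (u : cech X A p) : cech Y A p :=
  cech_class_on (pull_on (sval (cid (cech_memP u)))).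

Lemma cech_pullback_class p (c : cocycle_on X A p) :
  cech_pullback (cech_class_on c) = cech_class_on (pull_on c).
Proof.
apply/cech_class_onP; apply: pull_on_cohomologous.
case: cid => /= c' E; rewrite /cech_class_on /= in E.
by rewrite -E; exact: Relation_Operators.rst_refl.
Qed.

End Pullback.

Section Bockstein.
Variables (R : realType) (X : topologicalType).

(* The graph of the connecting map of 0 -> Z -> C -> C^* -> 0: on some cover, v
   is represented by the coboundary of a logarithm of a representative of u. *)
Definition bockstein p (u : cech X (Cstar R) p) (v : cech X Zdisc p.+1) : Prop :=
  exists (U : open_cover X) (e : cocycle (Cstar R) U p) (n : cocycle Zdisc U p.+1)
      (f : cochain (Cplx R) U p),
    [/\ is_cochain f,
        forall t x, cap t x -> val (cocycle_val e t x) = cexp2pi (f t x),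
        forall t x, cap t x -> delta f t x = (cocycle_val n t x : int)%:~R,
        u = cech_class e &
        v = cech_class n].

Definition bockstein_isomorphism p : Prop :=
  (forall u : cech X (Cstar R) p, exists! v, bockstein u v) /\
  (forall v : cech X Zdisc p.+1, exists! u, bockstein u v).
End Bockstein.

Definition locally_split (X Y : topologicalType) (p : Y -> X) : Prop :=
  (forall x, exists y, p y = x) /\
  exists U : open_cover X, forall i, exists s : X -> Y,
    {within U i, continuous s} /\ forall x, U i x -> p (s x) = x.

Section Gerbes.
Variables (R : realType) (X Y : topologicalType) (p : Y -> X).

(* For nonzero vectors t y in the fibres of L (no continuity required), d(dt) is
   the element of the fibre of d^2 L which the canonical trivialization,
   contracting each factor of L with its dual, sends to 1; it does not depend
   on t. *)
Definition is_canonical_d2 k (L : line_bundle R (fibprod p k))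
    (u : lsection (dbundle (dbundle L))) : Prop :=
  forall t : lsection L, nonvanishing_on setT t ->
    forall y, u y = dsection (dsection t) y.

Record bundle_gerbe := BundleGerbe {
  gerbe_bundle :> line_bundle R (fibprod p 2) ;
  gerbe_section : lsection (dbundle gerbe_bundle) ;
  gerbe_section_continuous : continuous_section_on setT gerbe_section ;
  gerbe_section_neq0 : nonvanishing_on setT gerbe_section ;
  gerbe_section_canonical : is_canonical_d2 (dsection gerbe_section) }.

(* With U, V the base and top covers, the map of covers from V to U lifting p is
   (j, y) |-> (proj_index j, p y), and the one from U to V is
   (i, x) |-> (sect_index i, sect i x). That the fibre products of V over U cover
   the fibre products of Y over X (fibre_covering) does not follow from the
   other conditions. *)
Record admissible_pair := AdmissiblePair {
  base_cover : open_cover X ;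
  top_cover : open_cover Y ;
  proj_index : cover_index top_cover -> cover_index base_cover ;
  proj_member : forall j y, top_cover j y -> base_cover (proj_index j) (p y) ;
  sect_index : cover_index base_cover -> cover_index top_cover ;
  sect : cover_index base_cover -> X -> Y ;
  sect_continuous : forall i, {within base_cover i, continuous (sect i)} ;
  sect_member : forall i x, base_cover i x -> top_cover (sect_index i) (sect i x) ;
  sect_lift : forall i x, base_cover i x -> p (sect i x) = x ;
  proj_sect_index : forall i, proj_index (sect_index i) = i ;
  sect_admissible : forall i1 i2, base_cover i1 `&` base_cover i2 !=set0 ->
    exists2 j2, proj_index j2 = i2 &
      sect i1 @` (base_cover i1 `&` base_cover i2) `<=` top_cover j2 ;
  fibre_covering : forall k (y : fibprod p k),
    exists t : fibtuple proj_index k,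
      forall l, top_cover (sval t l) (fpcoord l y) }.

Section Covers.
Variables (P : admissible_pair) (k : nat).

Definition fibre_member (t : fibtuple (@proj_index P) k) : set (fibprod p k) :=
  [set y | forall l, top_cover P (sval t l) (fpcoord l y)].

Lemma fibre_member_open t : open (fibre_member t).
Proof.
apply: open_forall => l.
by move/continuousP: (@fpcoord_continuous _ _ p k l); apply; exact: member_open.
Qed.

Definition fibre_cover : open_cover (fibprod p k) :=
  OpenCover fibre_member_open (@fibre_covering P k).
End Covers.

(* d = pi_0^* - pi_1^* from cochains on Y to cochains on the double fibre
   product; pi_j omits the j-th coordinate. *)
Definition dcochain (A : topologicalZmodType) (P : admissible_pair) q
    (b : cochain A (top_cover P) q) : cochain A (fibre_cover P 2) q :=
  fun t y => \sum_(j < 2)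
    b (fun l => sval (t l) (lift j ord0)) (fpcoord (lift j ord0) y)
      *~ (-1) ^+ j.

Definition is_transition_cocycle (L : line_bundle R (fibprod p 2))
    (V : open_cover (fibprod p 2)) (sigma : cover_index V -> lsection L)
    (c : cochain (Cstar R) V 1) : Prop :=
  forall t y, cap t y ->
    sigma (t ord_max) y = val (c t y) *: sigma (t ord0) y.

Definition is_dixmier_douady (G : bundle_gerbe) (alpha : cech X Zdisc 3) : Prop :=
  exists (P : admissible_pair)
      (sigma : cover_index (fibre_cover P 2) -> lsection G)
      (c : cochain (Cstar R) (fibre_cover P 2) 1)
      (beta : cochain (Cstar R) (top_cover P) 1)
      (a : cocycle (Cstar R) (base_cover P) 2),
    [/\ forall t, continuous_section_on (fibre_cover P 2 t) (sigma t) /\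
                  nonvanishing_on (fibre_cover P 2 t) (sigma t),
        forall (t : cover_index (fibre_cover P 3)) y, fibre_cover P 3 t y ->
          bigtensorv (fun j : 'I_3 =>
            signv (odd j) (sigma (omit j t) (fpomit j y)))
          = gerbe_section G y,
        is_transition_cocycle sigma c &
        [/\ is_cochain beta,
            eq_cochain c (oppc (dcochain beta)),
            forall t y, cap t y -> delta beta t y
              = cocycle_val a (fun l => proj_index (t l)) (p y) &
            bockstein (cech_class a) alpha]].

End Gerbes.

(* Main.v *)
(** If alpha = DD(L), the cochain beta of the Dixmier-Douady construction
    exhibits pi^* a as a coboundary, so pi^* alpha = 0 by naturality and
    injectivity of the Bockstein map.  Conversely, let a be a C^*-valued cocycle
    for alpha.  Since pi^* a is cohomologous to zero, on a sufficiently fine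
    admissible pair it equals delta beta for a 1-cochain beta, after correcting
    by the chain homotopy between two refinement maps.  Then c = - d beta is
    closed for both delta and d: the former lets c glue a line bundle on
    Y^[2], the latter makes the simplicial differentials of the glueing
    sections agree and so trivialize dL on Y^[3]. *)

From HB Require Import structures.
From mathcomp Require Import all_boot all_order all_algebra.
From mathcomp Require Import complex.
From mathcomp Require Import all_classical all_reals all_analysis.
From mathcomp Require Import ring.
From Stdlib Require Relation_Operators.
Require Import Defs.

Set Implicit Arguments.
Unset Strict Implicit.
Unset Printing Implicit Defensive.

Import Order.TTheory GRing.Theory Num.Theory.
Import numFieldNormedType.Exports.

Local Open Scope classical_set_scope.
Local Open Scope ring_scope.

(** * Cochains of low degree *)

Definition tup2 (T : Type) (a b : T) : 'I_2 -> T := fun i => nth a [:: a; b] i.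

Definition tup3 (T : Type) (a b c : T) : 'I_3 -> T :=
  fun i => nth a [:: a; b; c] i.

Definition tup4 (T : Type) (a b c d : T) : 'I_4 -> T :=
  fun i => nth a [:: a; b; c; d] i.

Lemma tup2E (T : Type) (t : 'I_2 -> T) : t = tup2 (t ord0) (t ord_max).
Proof.
by apply/funext => -[[|[|//]] hi]; rewrite /tup2 /=; congr t; apply: val_inj.
Qed.

Lemma tup3E (T : Type) (t : 'I_3 -> T) :
  t = tup3 (t ord0) (t (lift ord0 ord0)) (t ord_max).
Proof.
by apply/funext => -[[|[|[|//]]] hi]; rewrite /tup3 /=; congr t; apply: val_inj.
Qed.

Section DeltaLowDegree.
Variables (X : topologicalType) (A : topologicalZmodType) (U : open_cover X).
Implicit Types (i j k l : cover_index U) (x : X).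

Lemma delta1E (c : cochain A U 1) i j k x :
  delta c (tup3 i j k) x
    = c (tup2 j k) x - c (tup2 i k) x + c (tup2 i j) x.
Proof.
rewrite /delta !big_ord_recl big_ord0 addr0 /= addrA.
rewrite /bump /= expr0 expr1 sqrrN expr1n !mulr1z mulrN1z.
by congr (c _ _ - c _ _ + c _ _); apply/funext => -[[|[|//]] hi].
Qed.

Lemma delta2E (c : cochain A U 2) i j k l x :
  delta c (tup4 i j k l) x
    = c (tup3 j k l) x - c (tup3 i k l) x + c (tup3 i j l) x - c (tup3 i j k) x.
Proof.
rewrite /delta !big_ord_recl big_ord0 addr0 /= !addrA.
rewrite /bump /= expr0 expr1 sqrrN expr1n [_ ^+ 3]exprS sqrrN expr1n mulr1.
rewrite !mulr1z !mulrN1z.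
by congr (c _ _ - c _ _ + c _ _ - c _ _); apply/funext => -[[|[|[|//]]] hi].
Qed.

Lemma cap_tup2 i j x : cap (tup2 i j) x <-> U i x /\ U j x.
Proof.
split=> [h|[hi hj] -[[|[|//]] hl]] //.
by split; [exact: (h ord0)|exact: (h ord_max)].
Qed.

Lemma cap_tup3 i j k x : cap (tup3 i j k) x <-> [/\ U i x, U j x & U k x].
Proof.
split=> [h|[hi hj hk] -[[|[|[|//]]] hl]] //.
by split; [exact: (h ord0)|exact: (h (lift ord0 ord0))|exact: (h ord_max)].
Qed.

Lemma cap_tup4 i j k l x :
  [/\ U i x, U j x, U k x & U l x] -> cap (tup4 i j k l) x.
Proof. by case=> hi hj hk hl -[[|[|[|[|//]]]] hm]. Qed.

Lemma delta_addc n (c c' : cochain A U n) t x :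
  delta (addc c c') t x = delta c t x + delta c' t x.
Proof.
by rewrite /delta -big_split; apply: eq_bigr => s _; rewrite /addc mulrzDl.
Qed.

Lemma delta_oppc n (c : cochain A U n) t x :
  delta (oppc c) t x = - delta c t x.
Proof.
by rewrite /delta -sumrN; apply: eq_bigr => s _; rewrite /oppc mulNrz.
Qed.

Lemma addc_is_cochain n (c c' : cochain A U n) :
  is_cochain c -> is_cochain c' -> is_cochain (addc c c').
Proof.
move=> hc hc' t x tx.
apply: (@continuous_comp _ _ _ (fun x => (c t x, c' t x)) (fun z => z.1 + z.2)).
  by apply: continuous_pair; [apply: hc|apply: hc'].
exact: add_continuous.
Qed.

Lemma oppc_is_cochain n (c : cochain A U n) :
  is_cochain c -> is_cochain (oppc c).
Proof.
move=> hc t x tx; apply: (@continuous_comp _ _ _ (c t) -%R); first exact: hc.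
exact: opp_continuous.
Qed.

End DeltaLowDegree.

(** * Independence of the refinement map up to coboundary *)

(** The hypotheses are the cocycle relations on the three tetrahedra of a triangulated prism with
    bottom [aaa] and top [bbb]. In their alternating sum the inner faces [abb] and [aab] cancel;
    bottom, top and the three sides remain. *)
Lemma zmod_prism (V : zmodType) (bbb abb aab aaa abb' aab' ab0 aa1 a12 a02 : V) :
  bbb - abb + abb' - ab0 = 0 ->
  a12 - abb + aab - aa1 = 0 ->
  aab' - a02 + aab - aaa = 0 ->
  bbb - aaa = (a12 - aab') - (abb' - a02) + (ab0 - aa1).
Proof.
move=> E1 E2 E3; apply/eqP; rewrite -subr_eq0.
apply/eqP; transitivity ((bbb - abb + abb' - ab0) - (a12 - abb + aab - aa1)
    + (aab' - a02 + aab - aaa)); last by rewrite E1 E2 E3 subr0 addr0.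
rewrite !opprD !opprK !addrA.
by rewrite [RHS](ACl (1*12*5*9*3*10*4*8*(2*6)*(7*11))) /= !addNr !addr0.
Qed.

Section Restriction.
Variables (X : topologicalType) (A : topologicalZmodType).

Lemma restrictc_is_cochain (U V : open_cover X)
    (r : cover_index V -> cover_index U) n (c : cochain A U n) :
  refines r -> is_cochain c -> is_cochain (restrictc r c).
Proof. by move=> hr hc t x tx; apply: hc => l; exact: hr. Qed.

Lemma restrictc_closed (U V : open_cover X)
    (r : cover_index V -> cover_index U) n (c : cocycle A U n) :
  refines r -> eq_cochain (delta (restrictc r c)) (cochain0 A V n.+1).
Proof.
move=> hr t x tx.
by have := @cocycle_closed _ _ _ _ c (r \o t) x; apply=> l; exact: hr.
Qed.

(* The bounding cochain is the prism operator between r and r' applied to c. *)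
Lemma restrictc_homotopy (U V : open_cover X)
    (r r' : cover_index V -> cover_index U) (c : cocycle A U 2) :
  refines r -> refines r' ->
  is_coboundary (addc (restrictc r' c) (oppc (restrictc r c))).
Proof.
move=> hr hr'.
pose hA : cochain A V 1 :=
  fun t => cocycle_val c (tup3 (r (t ord0)) (r' (t ord0)) (r' (t ord_max))).
pose hB : cochain A V 1 :=
  fun t => cocycle_val c (tup3 (r (t ord0)) (r (t ord_max)) (r' (t ord_max))).
exists (addc hA (oppc hB)).
  apply: addc_is_cochain; last apply: oppc_is_cochain.
    move=> t x tx; rewrite /hA; refine (@cocycle_is_cochain _ _ _ _ c _ x _).
    apply/cap_tup3.
    by split; [apply: hr|apply: hr'|apply: hr'].
  move=> t x tx; rewrite /hB; refine (@cocycle_is_cochain _ _ _ _ c _ x _).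
  apply/cap_tup3.
  by split; [apply: hr|apply: hr|apply: hr'].
move=> t; rewrite (tup3E t); move: (t ord_max) (t (lift _ _)) (t ord0) => k j i x.
move=> /cap_tup3[Vi Vj Vk].
have U0 a b d e : U a x -> U b x -> U d x -> U e x ->
    cocycle_val c (tup3 b d e) x - cocycle_val c (tup3 a d e) x
      + cocycle_val c (tup3 a b e) x - cocycle_val c (tup3 a b d) x = 0.
  move=> Ua Ub Ud Ue; rewrite -delta2E.
  by apply: (cocycle_closed c); exact: cap_tup4.
have E s : restrictc s c (tup3 i j k) x = cocycle_val c (tup3 (s i) (s j) (s k)) x.
  by rewrite /restrictc [X in cocycle_val c X]tup3E.
rewrite delta1E /addc /oppc /hA /hB !E /=.
(* The three tetrahedra are [(r i, r' i, r' j, r' k)], [(r i, r j, r' j, r' k)] and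
   [(r i, r j, r k, r' k)]. *)
apply: zmod_prism; apply: U0; by [apply: hr|apply: hr'].
Qed.

End Restriction.

(** * Vanishing of Cech classes *)

Section Vanishing.
Variables (X : topologicalType) (A : topologicalZmodType).

Definition cap_cover (U V : open_cover X) : open_cover X :=
  @OpenCover X (cover_index U * cover_index V)%type
    (fun ij => U ij.1 `&` V ij.2)
    (fun ij => openI (member_open U ij.1) (member_open V ij.2))
    (fun x => let: ex_intro i Ui := member_cover U x in
              let: ex_intro j Vj := member_cover V x in
              ex_intro _ (i, j) (conj Ui Vj)).

Lemma coboundary_restrictc (U V : open_cover X)
    (r : cover_index V -> cover_index U) n (c : cochain A U n) :
  refines r -> is_coboundary c -> is_coboundary (restrictc r c).
Proof.
case: n c => [|n] c hr /=.
  by move=> hc t x tx; apply: (hc (r \o t)) => l; exact: hr.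
move=> [b hb E]; exists (restrictc r b); first exact: restrictc_is_cochain.
by move=> t x tx; apply: (E (r \o t)) => l; exact: hr.
Qed.

Lemma is_coboundary_add (U : open_cover X) n (c c' : cochain A U n.+1) :
  is_coboundary c -> is_coboundary c' -> is_coboundary (addc c c').
Proof.
move=> [b hb E] [b' hb' E']; exists (addc b b'); first exact: addc_is_cochain.
by move=> t x tx; rewrite delta_addc -E // -E'.
Qed.

Lemma is_coboundary_opp (U : open_cover X) n (c : cochain A U n.+1) :
  is_coboundary c -> is_coboundary (oppc c).
Proof.
move=> [b hb E]; exists (oppc b); first exact: oppc_is_cochain.
by move=> t x tx; rewrite delta_oppc -E.
Qed.

Lemma is_coboundary_ext (U : open_cover X) n (c c' : cochain A U n.+1) :
  (forall t x, c t x = c' t x) -> is_coboundary c -> is_coboundary c'.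
Proof. by move=> cc' [b hb E]; exists b => // t x tx; rewrite -cc' E. Qed.

(** Vanishing in the colimit, witnessed on a single refinement. In this form it can be carried along
    the zigzags that generate [cohomologous]. *)
Definition eventually_coboundary n (c : cocycle_on X A n) : Prop :=
  exists V (r : cover_index V -> cover_index (projT1 c)),
    refines r /\ is_coboundary (restrictc r (projT2 c)).

Lemma cohomologous_eventually_coboundary (c c' : cocycle_on X A 2) :
  cohomologous c c' -> eventually_coboundary c <-> eventually_coboundary c'.
Proof.
elim=> {c c'} [c c' [r hr cb]|//|c c' _ h|c d e _ -> _ -> //]; last first.
  by split=> /h.
split=> [[V [s [hs cbs]]]|[V [s [hs cbs]]]].
  (* The common refinement maps to the cover of [c] through [V] by [s] and through the cover of [c']
     by [r]. The prism homotopy exchanges these maps: [c'] is the sum of [c' - r^* c], [s^* c] and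
     [r^* c - s^* c]. *)
  exists (cap_cover V (projT1 c')), snd.
  have h2 : @refines _ (cap_cover V (projT1 c')) (projT1 c') snd by move=> ij x [].
  have h1 : @refines _ (cap_cover V (projT1 c')) V fst by move=> ij x [].
  split=> //.
  have := is_coboundary_add (coboundary_restrictc h2 cb)
    (is_coboundary_add (coboundary_restrictc h1 cbs)
      (@restrictc_homotopy _ _ _ (cap_cover V (projT1 c')) (s \o fst)
        (r \o snd) (projT2 c) _ _)).
  move/(_ (fun ij x h => hs _ _ (h1 _ _ h)) (fun ij x h => hr _ _ (h2 _ _ h))).
  apply: is_coboundary_ext => t x; rewrite /addc /oppc /restrictc /=.
  by rewrite [X in _ + X]addrC subrK subrK.
(* Here [V] already refines the cover of [c'], and [(r \o s)^* c] is [s^* c' - s^*(c' - r^* c)]. *)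
exists V, (r \o s); split=> [j x /hs /hr //|].
have := is_coboundary_add cbs
  (is_coboundary_opp (coboundary_restrictc hs cb)).
apply: is_coboundary_ext => t x; rewrite /addc /oppc /restrictc /=.
by rewrite opprD opprK addNKr.
Qed.

Lemma cohomologous_cocycle0 (U V : open_cover X) n :
  cohomologous (existT _ U (cocycle0 A U n)) (existT _ V (cocycle0 A V n)).
Proof.
have step W : cohom_step (existT _ (trivial_cover X) (cocycle0 A _ n))
    (existT _ W (cocycle0 A W n)).
  exists (fun=> tt); first by move=> j x.
  case: n => [|n] /=; first by move=> t x _; rewrite /addc /oppc subrr.
  exists (cochain0 A W n); first exact: cochain0_is_cochain.
  by move=> t x tx; rewrite cochain0_closed // /addc /oppc subrr.
apply: Relation_Operators.rst_trans; last exact/Relation_Operators.rst_step/step.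
by apply: Relation_Operators.rst_sym; apply/Relation_Operators.rst_step/step.
Qed.

Lemma cech_class0P (c : cocycle_on X A 2) :
  cech_class_on c = cech0 A 2 <-> eventually_coboundary c.
Proof.
rewrite cech_class_onP; split.
  move/cohomologous_eventually_coboundary/iffRL; apply.
  exists (trivial_cover X), id; split=> //.
  exists (cochain0 A _ 1); first exact: cochain0_is_cochain.
  by move=> t x tx; rewrite cochain0_closed.
move=> [V [r [hr cb]]].
apply: Relation_Operators.rst_trans (cohomologous_cocycle0 V _ _).
apply: Relation_Operators.rst_step; exists r => //=.
move/is_coboundary_opp: cb; apply: is_coboundary_ext => t x.
by rewrite /addc /oppc add0r.
Qed.

End Vanishing.

(** The pulled back cover keeps the index type of [U], so refinements of it and restrictions to them
    unfold to the conditions displayed. *)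
Lemma cech_pullback_class0P (X Y : topologicalType) (A : topologicalZmodType)
    (f : Y -> X) (cf : continuous f) (U : open_cover X) (c : cocycle A U 2) :
  cech_pullback cf (cech_class c) = cech0 A 2 <->
  exists (V : open_cover Y) (r : cover_index V -> cover_index U),
    (forall j y, V j y -> U (r j) (f y)) /\
    @is_coboundary _ A V 2 (fun t y => cocycle_val c (r \o t) (f y)).
Proof. by rewrite cech_pullback_class cech_class0P. Qed.

(** * Naturality of the Bockstein relation *)

Section BocksteinNaturality.
Variable R : realType.

Lemma cexp2pi0 : cexp2pi (0 : R[i]%C) = 1.
Proof. by rewrite /cexp2pi /= !mulr0 oppr0 expR0 cos0 sin0 mulr0 mulr1. Qed.

(** The zero of [Cstar] is the number 1, which has the logarithm 0. *)
Lemma bockstein0 (X : topologicalType) n :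
  @bockstein R X n (cech0 _ n) (cech0 _ n.+1).
Proof.
exists (trivial_cover X), (cocycle0 _ _ n), (cocycle0 _ _ n.+1), (cochain0 _ _ n).
split=> // [|t x tx|t x tx]; first exact: cochain0_is_cochain.
  by rewrite [RHS]cexp2pi0.
by rewrite cochain0_closed.
Qed.

Lemma bockstein_pullback (X Y : topologicalType) (f : Y -> X)
    (cf : continuous f) n (u : cech X (Cstar R) n) v :
  bockstein u v -> bockstein (cech_pullback cf u) (cech_pullback cf v).
Proof.
move=> [U [e [m [g [hg ge gm -> ->]]]]]; rewrite !cech_pullback_class.
exists (pullback_cover cf U), (pull_cocycle cf e), (pull_cocycle cf m),
  (fun t y => g t (f y)).
split=> // [t y ty|t y ty|t y ty]; last exact: gm; last exact: ge.
by apply: continuous_comp; [exact: cf|exact: hg].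
Qed.

End BocksteinNaturality.

(** * Arbitrarily fine admissible pairs *)

Section AdmissiblePairs.
Variables (X Y : topologicalType) (p : Y -> X).
Hypotheses (cp : continuous p) (splitp : locally_split p).

Lemma small_section (U : open_cover X) (V : open_cover Y) (x : X) :
  exists W : set X, [/\ open W, W x & exists (i : cover_index U)
    (j : cover_index V) (s : X -> Y), [/\ W `<=` U i, {within W, continuous s},
      forall z, W z -> V j (s z) & forall z, W z -> p (s z) = z]].
Proof.
case: splitp => _ [S hS].
have [i Ui] := member_cover U x; have [k Sk] := member_cover S x.
have [s [cs ps]] := hS k; have [j Vj] := member_cover V (s x).
have oS := member_open S k.
have oW : open (S k `&` s @^-1` V j).
  rewrite openE => z [Sz Vz]; apply: filterI; first exact: open_nbhs_nbhs.
  (* Since [S k] is open, continuity within it is continuity at each of its points. *)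
  move: cs; rewrite (continuous_open_subspace s oS) => /(_ z (mem_set Sz)); apply.
  by apply: open_nbhs_nbhs; split=> //; exact: member_open.
exists (U i `&` (S k `&` s @^-1` V j)); split=> //.
  by apply: openI => //; exact: member_open.
exists i, j, s; split=> [z []//||z [_ []]//|z [_ [Sz _]]]; last exact: ps.
by apply: continuous_subspaceW cs => z [_ []].
Qed.

(* The top cover refines the pullback of the base cover by all members of V, so
   a member of V containing the image of a section lies over every base member. *)
Lemma fine_admissible_pair (U : open_cover X) (V : open_cover Y) :
  exists (P : admissible_pair p)
    (r : cover_index (base_cover P) -> cover_index U)
    (q : cover_index (top_cover P) -> cover_index V), refines r /\ refines q.
Proof.
have [W hW] := choice (small_section U V).
have [r hr] := choice (fun x => let: And3 _ _ h := hW x in h).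
have [v hv] := choice hr; have [s hs] := choice hv.
pose BC := @OpenCover X X W (fun x => let: And3 h _ _ := hW x in h)
  (fun x => ex_intro _ x (let: And3 _ h _ := hW x in h)).
have oT (ij : X * cover_index V) : open (p @^-1` W ij.1 `&` V ij.2).
  apply: openI; last exact: member_open.
  by move/continuousP: cp; apply; exact: (member_open BC).
have cT y : exists ij : X * cover_index V, (p @^-1` W ij.1 `&` V ij.2) y.
  have [j Vj] := member_cover V y; exists (p y, j); split=> //=.
  by have [] := hW (p y).
pose TC := OpenCover oT cT.
have h1 (j : cover_index TC) y : TC j y -> BC j.1 (p y) by case.
have h2 x z : BC x z -> TC (x, v x) (s x z).
  by move=> Wz; have [_ _ h3 h4] := hs x; split; [rewrite /= h4|apply: h3].
have h3 (x1 x2 : X) : BC x1 `&` BC x2 !=set0 -> exists2 j2 : cover_index TC,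
    j2.1 = x2 & s x1 @` (BC x1 `&` BC x2) `<=` TC j2.
  move=> _; exists (x2, v x1) => // y [z [W1 W2] <-].
  by have [_ _ h5 h4] := hs x1; split; [rewrite /= h4|apply: h5].
have h4 k (y : fibprod p k) : exists t : fibtuple (fst : cover_index TC -> X) k,
    forall l, TC (sval t l) (fpcoord l y).
  (* Base members are indexed by points of [X], so each coordinate can be given its own image as
     base index. The coordinates of [y] have a common image, hence these indices agree. *)
  have ht l : exists ij : X * cover_index V,
      TC ij (fpcoord l y) /\ ij.1 = p (fpcoord l y).
    have [j Vj] := member_cover V (fpcoord l y).
    exists (p (fpcoord l y), j); split=> //; split=> //=.
    by have [] := hW (p (fpcoord l y)).
  have [t tP] := choice ht.
  have t1 i j : (t i).1 = (t j).1.
    by rewrite (tP i).2 (tP j).2; have /set_mem := valP y; apply.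
  exists (exist (fun t : 'I_k -> cover_index TC => forall i j, (t i).1 = (t j).1)
    t t1) => l.
  exact: (tP l).1.
exists (@AdmissiblePair _ _ p BC TC fst h1 (fun x => (x, v x)) s
  (fun x => let: And4 _ h _ _ := hs x in h) h2
  (fun x => let: And4 _ _ _ h := hs x in h) (fun=> erefl) h3 h4), r, snd.
by split=> [x|j y []//] /=; have [] := hs x.
Qed.

End AdmissiblePairs.

(** * Frames and line bundles glued from cocycles *)

Section TensorScaling.
Variables (K : fieldType) (n : nat) (e : 'I_n -> bool).

Lemma bigtensorv_signvZ (V : 'I_n -> vectType K) (v w : forall i, V i)
    (a : 'I_n -> K) :
  (forall i, dim (V i) = 1%N) -> (forall i, w i != 0) -> (forall i, a i != 0) ->
  (forall i, v i = a i *: w i) ->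
  bigtensorv (fun i => signv (e i) (v i))
    = (\prod_(i < n) (if e i then (a i)^-1 else a i))
        *: bigtensorv (fun i => signv (e i) (w i)).
Proof.
move=> dV w0 a0 vE; rewrite -bigtensorvZ; congr bigtensorv.
by apply: functional_extensionality_dep => i; rewrite vE signvZ.
Qed.

End TensorScaling.

Section Frames.
Variables (R : realType) (B : topologicalType).

(** The section is the chart map [(b, z) |-> z *: s b] on the slice [z = 1]. *)
Lemma frame_continuous (L : line_bundle R B) U (s : lsection L) :
  frames L (U, s) -> continuous_section_on U s.
Proof.
move=> [/= oU s0 hs] b Ub A /=; rewrite nbhsE => -[W [oW Wb] WA].
(* A local frame only tests sets lying over [U]; the part over [U] is therefore shown to be open
   first, and then intersected with [W]. *)
pose Cyl : set {b : B & fiber L b} := [set e | U (projT1 e)].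
have oCyl : total_open Cyl.
  apply/(hs Cyl) => //; rewrite (_ : chart _ _ _ = [set bz | U bz.1]).
    exact: cylinder_open.
  by apply/seteqP; split=> bz //= -[].
have : open (chart U s (Cyl `&` W)).
  by apply/hs => [e []//|]; exact: total_openI.
move=> oc; have nb : nbhs (b, 1 : Cplx R) (chart U s (Cyl `&` W)).
  apply: open_nbhs_nbhs; split=> //; split=> //; split=> //=.
  by rewrite scale1r.
have cp1 : {for b, continuous (fun c : B => (c, 1 : Cplx R))}.
  refine (@continuous_pair B B (Cplx R) id (fun=> 1) _ _ _); first exact: cvg_id.
  exact: cvg_cst.
move: nb => /cp1 /= nb.
apply: (@filterS _ (nbhs b) _ _ _ _ nb) => c [_ [_]] /=.
by rewrite scale1r => /WA.
Qed.

Lemma continuous_section_eq (L : line_bundle R B) U (s s' : lsection L) :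
  open U -> (forall b, U b -> s b = s' b) ->
  continuous_section_on U s -> continuous_section_on U s'.
Proof.
move=> oU ss' cs b Ub A; rewrite -(ss' b Ub) => /(cs b Ub) nA.
have nU : nbhs b U by exact: open_nbhs_nbhs.
by apply: filterS2 nU nA => c Uc; rewrite /= ss'.
Qed.

End Frames.

Section Gluing.
Variables (R : realType) (B : topologicalType) (V : open_cover B).
Variable c : cocycle (Cstar R) V 1.

Lemma cocycle1D i j k b : V i b -> V j b -> V k b ->
  cocycle_val c (tup2 i k) b
    = cocycle_val c (tup2 j k) b + cocycle_val c (tup2 i j) b.
Proof.
move=> Vi Vj Vk; have := @cocycle_closed _ _ _ _ c (tup3 i j k) b.
move=> /(_ ((cap_tup3 _ _ _ _).2 (And3 Vi Vj Vk))).
by rewrite delta1E addrAC => /eqP; rewrite subr_eq0 => /eqP.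
Qed.

Definition base_index (b : B) : cover_index V := sval (cid (member_cover V b)).

Lemma base_indexP b : V (base_index b) b.
Proof. exact: (svalP (cid (member_cover V b))). Qed.

(** The fibre at [b] is identified with C through the frame of the chosen member [base_index b]. The
    choice need not vary continuously, because the topology of the bundle is defined by these
    sections alone. *)
Definition glue_section (i : cover_index V) (b : B) : (Cplx R)^o :=
  val (cocycle_val c (tup2 (base_index b) i) b).

Definition glue_frames : set (set B * (B -> (Cplx R)^o)) :=
  [set u | exists i, u = (V i : set B, glue_section i)].

Lemma glue_section_trans i j b : V i b -> V j b ->
  glue_section j b = val (cocycle_val c (tup2 i j) b) *: glue_section i b.
Proof.
by move=> Vi Vj; rewrite /glue_section (cocycle1D (base_indexP b) Vi Vj).
Qed.

Lemma glue_section_neq0 i b : glue_section i b != 0.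
Proof. exact: (valP (cocycle_val c (tup2 (base_index b) i) b)). Qed.

Lemma glue_frames_trans u v : glue_frames u -> glue_frames v ->
  exists g : B -> Cplx R, forall b, u.1 b -> v.1 b ->
    {for b, continuous g} /\ v.2 b = g b *: u.2 b.
Proof.
move=> [i ->] [j ->]; exists (fun b => val (cocycle_val c (tup2 i j) b)) => b /= Vi Vj.
split; last exact: glue_section_trans.
apply: continuous_comp; last exact: Cstar_val_continuous.
by apply: cocycle_is_cochain; apply/cap_tup2.
Qed.

Lemma glue_frames_open u : glue_frames u -> open u.1.
Proof. by move=> [i ->]; exact: member_open. Qed.

Lemma glue_frames_neq0 u : glue_frames u -> forall b, u.1 b -> u.2 b != 0.
Proof. by move=> [i ->] b _; exact: glue_section_neq0. Qed.

Lemma glue_frames_cover b : exists2 u, glue_frames u & u.1 b.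
Proof.
have [i Vi] := member_cover V b.
by exists (V i : set B, glue_section i) => //; exists i.
Qed.

Lemma dim_regular (b : B) : dim ((Cplx R)^o : vectType (Cplx R)) = 1%N.
Proof. by []. Qed.

Definition glued_bundle : line_bundle R B :=
  bundle_of_frames dim_regular glue_frames_open glue_frames_neq0
    glue_frames_cover glue_frames_trans.

Definition glued_section i : lsection glued_bundle := glue_section i.

Lemma glued_frame i : frames glued_bundle (V i : set B, glued_section i).
Proof.
apply: (frame_local_frame glue_frames_open glue_frames_neq0 glue_frames_trans).
by exists i.
Qed.

End Gluing.

(** * The simplicial differential on frames and cochains *)

Section SimplicialCochains.
Variables (X Y : topologicalType) (p : Y -> X).

(** [dbundle] is built by pulling back, dualizing the odd factors and tensoring. At each stage the
    topology is defined by the frames induced from the previous one, and these are local frames for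
    it. *)
Lemma dbundle_frame (R : realType) k (L : line_bundle R (fibprod p k))
    (U : 'I_k.+1 -> set (fibprod p k)) (s : 'I_k.+1 -> lsection L) :
  (forall j, frames L (U j, s j)) ->
  frames (dbundle L) ([set y | forall j, U j (fpomit j y)],
    fun y => bigtensorv (fun j => signv (odd j) (s j (fpomit j y)))).
Proof.
move=> Us; apply: (frame_local_frame (@bigtensor_frames_open _ _ _ _)
  (@bigtensor_frames_neq0 _ _ _ _) (@bigtensor_frames_trans _ _ _ _)).
exists (fun j => (@fpomit _ _ p k j @^-1` U j,
  fun y => signv (odd j) (s j (fpomit j y)))) => // j.
apply: (frame_local_frame (@sign_frames_open _ _ _ _)
  (@sign_frames_neq0 _ _ _ _) (@sign_frames_trans _ _ _ _)).
exists (@fpomit _ _ p k j @^-1` U j, fun y => s j (fpomit j y)) => //.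
apply: (frame_local_frame (@pullback_frames_open _ _ _ _ (@fpomit_continuous _ _ p k j) _)
  (@pullback_frames_neq0 _ _ _ _ _)
  (@pullback_frames_trans _ _ _ _ (@fpomit_continuous _ _ p k j) _)).
by exists (U j, s j).
Qed.

(** Simplicial identities, with the equality of composite cofaces as hypothesis so that it can be
    checked by enumeration for concrete indices. *)
Lemma omit_omit (A B : Type) (f : A -> B) k (i i' : 'I_k.+1) (j j' : 'I_k.+2)
    (t : fibtuple f k.+2) :
  (forall l, lift j (lift i l) = lift j' (lift i' l)) ->
  omit i (omit j t) = omit i' (omit j' t).
Proof.
move=> E; apply: eq_exist; apply/funext => l /=.
by rewrite E.
Qed.

Lemma fpomit_fpomit k (i i' : 'I_k.+1) (j j' : 'I_k.+2) (y : fibprod p k.+2) :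
  (forall l, lift j (lift i l) = lift j' (lift i' l)) ->
  fpomit i (fpomit j y) = fpomit i' (fpomit j' y).
Proof.
move=> E; apply: val_inj; apply/funext => l.
by rewrite -[LHS]/(fpcoord (lift j (lift i l)) y) E.
Qed.

Variable P : admissible_pair p.

Lemma omit_member k (j : 'I_k.+1) (t : cover_index (fibre_cover P k.+1)) y :
  fibre_cover P k.+1 t y -> fibre_cover P k (omit j t) (fpomit j y).
Proof. by move=> ty l; exact: ty. Qed.

Variable A : topologicalZmodType.

(** Omitting the first coordinate leaves the last one, whose term is thus the positive one. *)
Lemma dcochainE n (b : cochain A (top_cover P) n) t y :
  dcochain b t y
    = b (fun l => sval (t l) ord_max) (fpcoord ord_max y)
      - b (fun l => sval (t l) ord0) (fpcoord ord0 y).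
Proof.
rewrite /dcochain !big_ord_recl big_ord0 addr0 /= expr0 expr1 mulr1z mulrN1z.
have -> : lift ord0 ord0 = ord_max :> 'I_2 by exact: val_inj.
by have -> : lift ord_max ord0 = ord0 :> 'I_2 by exact: val_inj.
Qed.

Lemma dcochain_is_cochain n (b : cochain A (top_cover P) n) :
  is_cochain b -> is_cochain (dcochain b).
Proof.
move=> hb t y ty.
have cb i : {for y, continuous
    (fun y : fibprod p 2 => b (fun l => sval (t l) i) (fpcoord i y))}.
  apply: continuous_comp; first exact: fpcoord_continuous.
  by apply: hb => l; exact: ty.
rewrite (_ : dcochain b t = fun y =>
  b (fun l => sval (t l) ord_max) (fpcoord ord_max y)
  - b (fun l => sval (t l) ord0) (fpcoord ord0 y)); last first.
  by apply/funext => z; exact: dcochainE.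
apply: (@continuous_comp _ (A * A)%type _
  (fun y => (b (fun l => sval (t l) ord_max) (fpcoord ord_max y),
             b (fun l => sval (t l) ord0) (fpcoord ord0 y)))
  (fun z => z.1 - z.2)); last exact: sub_continuous.
by apply: continuous_pair; exact: cb.
Qed.

Lemma delta_dcochain n (b : cochain A (top_cover P) n) t y :
  delta (dcochain b) t y
    = delta b (fun l => sval (t l) ord_max) (fpcoord ord_max y)
      - delta b (fun l => sval (t l) ord0) (fpcoord ord0 y).
Proof.
rewrite /delta -sumrB; apply: eq_bigr => j _.
by rewrite dcochainE mulrzBl.
Qed.

End SimplicialCochains.

Lemma val_alternating_sum (R : realType) n (e : 'I_n -> bool)
    (c : 'I_n -> Cstar R) :
  val (\sum_(i < n) (if e i then - c i else c i))
    = \prod_(i < n) (if e i then (val (c i))^-1 else val (c i)) :> Cplx R.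
Proof.
rewrite (big_morph (fun x : Cstar R => val x : Cplx R) (id1 := 1) (op1 := *%R)) //.
by apply: eq_bigr => i _; case: (e i).
Qed.

(** * The bundle gerbe of a cochain *)

Section CochainGerbe.
Variables (R : realType) (X Y : topologicalType) (p : Y -> X).
Variables (P : admissible_pair p) (beta : cochain (Cstar R) (top_cover P) 1).
Variable a : cochain (Cstar R) (base_cover P) 2.
Hypothesis beta_is_cochain : is_cochain beta.
Hypothesis delta_beta : forall t y, cap t y ->
  delta beta t y = a (fun l => proj_index (t l)) (p y).

Definition gerbe_cochain : cochain (Cstar R) (fibre_cover P 2) 1 :=
  oppc (dcochain beta).

Lemma gerbe_cochain_is_cochain : is_cochain gerbe_cochain.
Proof. by apply: oppc_is_cochain; exact: dcochain_is_cochain. Qed.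

(** As [delta] commutes with [d], the coboundary is [- d] of the pullback of [a]. Both coordinates
    of [y] lie over the same point and their indices over the same base indices, so the two terms
    cancel. *)
Lemma gerbe_cochain_closed :
  eq_cochain (delta gerbe_cochain) (cochain0 _ (fibre_cover P 2) 2).
Proof.
move=> t y ty; rewrite delta_oppc delta_dcochain.
rewrite !delta_beta => [|l|l]; [|exact: ty|exact: ty].
have -> : (fun l => proj_index (sval (t l) ord0))
    = (fun l => proj_index (sval (t l) ord_max)).
  by apply/funext => l; exact: (proj2_sig (t l)).
have /set_mem/(_ ord0 ord_max) pE := valP y.
by rewrite [p (fpcoord ord0 y)]pE subrr oppr0.
Qed.

Definition gerbe_cocycle : cocycle (Cstar R) (fibre_cover P 2) 1 :=
  Cocycle gerbe_cochain_is_cochain gerbe_cochain_closed.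

Lemma gerbe_cocycle_tup2 (t t' : cover_index (fibre_cover P 2)) y :
  cocycle_val gerbe_cocycle (tup2 t t') y
    = beta (tup2 (sval t ord0) (sval t' ord0)) (fpcoord ord0 y)
      - beta (tup2 (sval t ord_max) (sval t' ord_max)) (fpcoord ord_max y).
Proof.
rewrite /= /gerbe_cochain /oppc dcochainE opprB.
by congr (beta _ _ - beta _ _); rewrite [LHS]tup2E.
Qed.

Local Notation L := (glued_bundle gerbe_cocycle).
Local Notation sigma := (glued_section gerbe_cocycle).

Definition dsigma (t : cover_index (fibre_cover P 3)) : lsection (dbundle L) :=
  fun y => bigtensorv (fun j : 'I_3 =>
    signv (odd j) (sigma (omit j t) (fpomit j y))).

(** Changing the index multiplies by the alternating product of transition functions over the three
    faces. This is [d] of the cocycle [- d beta], which is trivial since [d] squares to zero. *)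
Lemma dsigma_eq t t' y : fibre_cover P 3 t y -> fibre_cover P 3 t' y ->
  dsigma t y = dsigma t' y.
Proof.
move=> ty t'y; rewrite /dsigma.
pose c j := cocycle_val gerbe_cocycle (tup2 (omit j t') (omit j t)) (fpomit j y).
rewrite (bigtensorv_signvZ (fun j : 'I_3 => odd j)
  (w := fun j : 'I_3 => sigma (omit j t') (fpomit j y))
  (a := fun j => val (c j))) => [|//|j|j|j].
(* [F l] is [beta] at vertex [l]. The faces contribute [F 1 - F 2], [F 0 - F 2] and [F 0 - F 1],
   with alternating sum zero; the rewrites below identify the composite [lift]s naming the same
   vertex. *)
- pose F (l : 'I_3) := beta (tup2 (sval t' l) (sval t l)) (fpcoord l y).
  have cE j : c j = F (lift j ord0) - F (lift j ord_max).
    exact: gerbe_cocycle_tup2.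
  rewrite -val_alternating_sum (_ : \sum_(j < 3) _ = 0) ?scale1r //.
  rewrite !big_ord_recl big_ord0 addr0 /= !cE opprB addrA.
  rewrite (_ : lift ord0 ord0 = lift ord_max ord_max :> 'I_3); last exact: val_inj.
  rewrite (_ : lift (lift ord_max ord_max) ord_max = lift ord0 ord_max :> 'I_3);
    last exact: val_inj.
  rewrite (_ : lift (lift ord0 _) ord0 = lift (lift ord_max ord_max) ord0 :> 'I_3);
    last exact: val_inj.
  rewrite (_ : lift (lift ord0 _) ord_max = lift ord_max ord_max :> 'I_3);
    last exact: val_inj.
  by rewrite !addrA !subrK subrr.
- exact: glue_section_neq0.
- exact: (valP (c j)).
- by apply: glue_section_trans; exact: omit_member.
Qed.

Lemma dsigma_continuous t : continuous_section_on (fibre_cover P 3 t) (dsigma t).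
Proof.
have /frame_continuous := dbundle_frame (fun j : 'I_3 =>
  glued_frame gerbe_cocycle (omit j t)).
by move=> h y ty; apply: h => j; exact: omit_member.
Qed.

(** The index is chosen pointwise; by [dsigma_eq] the choice does not affect the value, so near each
    point this is one continuous [dsigma t]. *)
Definition gerbe_triv : lsection (dbundle L) :=
  fun y => dsigma (base_index (fibre_cover P 3) y) y.

Lemma gerbe_trivE t y : fibre_cover P 3 t y -> gerbe_triv y = dsigma t y.
Proof. by move=> ty; apply: dsigma_eq => //; exact: base_indexP. Qed.

Lemma gerbe_triv_continuous : continuous_section_on setT gerbe_triv.
Proof.
move=> y _; have [t ty] := member_cover (fibre_cover P 3) y.
apply: (@continuous_section_eq _ _ _ (fibre_cover P 3 t) (dsigma t)) => //.
- exact: member_open.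
- by move=> z tz; rewrite (gerbe_trivE tz).
- exact: dsigma_continuous.
Qed.

Lemma gerbe_triv_neq0 : nonvanishing_on setT gerbe_triv.
Proof.
move=> y _; apply: bigtensorv_neq0 => j.
by apply: signv_neq0; exact: glue_section_neq0.
Qed.

(** Relative to an arbitrary nonvanishing [s], the glueing sections are scalar multiples with ratios
    [rho]. The differential of the trivialization is then [d d s] times an alternating product of
    these ratios over the double faces. *)
Lemma gerbe_triv_canonical : is_canonical_d2 (dsection gerbe_triv).
Proof.
(* All faces are taken from one index [T], so that a double face reached in two ways carries the
   same glueing section. *)
move=> s s0 y; have [T Ty] := member_cover (fibre_cover P 4) y.
pose rho t z : Cplx R := coord [tuple s z] ord0 (sigma t z).
have sE t z : sigma t z = rho t z *: s z by apply: coord_line; [|exact: s0].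
have rho0 t z : rho t z != 0.
  by apply: contra_neq (glue_section_neq0 gerbe_cocycle t z) => r0;
    rewrite -[LHS]/(sigma t z) sE r0 scale0r.
pose g (j : 'I_4) (i : 'I_3) := rho (omit i (omit j T)) (fpomit i (fpomit j y)).
have g0 j i : g j i != 0 by exact: rho0.
have gE (i i' : 'I_3) (j j' : 'I_4) :
    (forall l : 'I_2, lift j (lift i l) = lift j' (lift i' l)) ->
    g j i = g j' i'.
  by move=> E; rewrite /g (omit_omit _ E) (fpomit_fpomit _ E).
pose h j := \prod_(i < 3) (if odd i then (g j i)^-1 else g j i).
have h0 j : h j != 0.
  by apply/prodf_neq0 => i _; case: ifP => _ //; rewrite invr_eq0.
have hE j : gerbe_triv (fpomit j y) = h j *: dsection s (fpomit j y).
  rewrite (gerbe_trivE (omit_member j Ty)).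
  apply: (bigtensorv_signvZ (fun i : 'I_3 => odd i)
    (w := fun i : 'I_3 => s (fpomit i (fpomit j y))) (a := g j)) => [//|i|i|i].
  - exact: s0.
  - exact: g0.
  - exact: sE.
rewrite [LHS](bigtensorv_signvZ (fun j : 'I_4 => odd j)
  (w := fun j : 'I_4 => dsection s (fpomit j y)) (a := h)) => [|j|j|//|//].
- rewrite (_ : \prod_(j < 4) _ = 1) ?scale1r //.
  pose o0 : 'I_3 := ord0; pose o1 : 'I_3 := lift ord0 ord0.
  pose o2 : 'I_3 := lift ord0 (lift ord0 ord0).
  pose q0 : 'I_4 := ord0; pose q1 : 'I_4 := lift ord0 ord0.
  pose q2 : 'I_4 := lift ord0 (lift ord0 ord0).
  pose q3 : 'I_4 := lift ord0 (lift ord0 (lift ord0 ord0)).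
  (* The faces (j, i) and (i, j - 1) of T agree for i < j, so the twelve
     ratios cancel in pairs. *)
  have E1 : g q1 o0 = g q0 o0 by apply: gE => -[[|[|//]] ?]; exact: val_inj.
  have E2 : g q2 o0 = g q0 o1 by apply: gE => -[[|[|//]] ?]; exact: val_inj.
  have E3 : g q3 o0 = g q0 o2 by apply: gE => -[[|[|//]] ?]; exact: val_inj.
  have E4 : g q2 o1 = g q1 o1 by apply: gE => -[[|[|//]] ?]; exact: val_inj.
  have E5 : g q3 o1 = g q1 o2 by apply: gE => -[[|[|//]] ?]; exact: val_inj.
  have E6 : g q3 o2 = g q2 o2 by apply: gE => -[[|[|//]] ?]; exact: val_inj.
  rewrite /h !big_ord_recl !big_ord0 /=.
  rewrite -/o0 -/o1 -/o2 -/q0 -/q1 -/q2 -/q3 E1 E2 E3 E4 E5 E6.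
  by field; rewrite !g0.
- exact: (fiber_dim (dbundle L)).
- by apply: bigtensorv_neq0 => i; apply: signv_neq0; exact: s0.
Qed.

Definition cochain_gerbe : bundle_gerbe R p :=
  BundleGerbe gerbe_triv_continuous gerbe_triv_neq0 gerbe_triv_canonical.

End CochainGerbe.

Lemma cochain_gerbe_dixmier_douady (R : realType) (X Y : topologicalType)
    (p : Y -> X) (P : admissible_pair p)
    (beta : cochain (Cstar R) (top_cover P) 1)
    (a : cocycle (Cstar R) (base_cover P) 2) (hb : is_cochain beta)
    (db : forall t y, cap t y ->
      delta beta t y = cocycle_val a (fun l => proj_index (t l)) (p y))
    (alpha : cech X Zdisc 3) :
  bockstein (cech_class a) alpha ->
  is_dixmier_douady (cochain_gerbe hb db) alpha.
Proof.
move=> ba; exists P, (glued_section (gerbe_cocycle hb db)),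
  (gerbe_cochain beta), beta, a; split=> //.
- move=> t; split; last by move=> y _; exact: glue_section_neq0.
  exact: frame_continuous (glued_frame _ t).
- by move=> t y ty; rewrite /= (gerbe_trivE hb db ty).
- move=> t y ty; rewrite {2}(tup2E t).
  exact: glue_section_trans (ty ord0) (ty ord_max).
Qed.

(** * Representatives on admissible pairs *)

Section Representatives.
Variables (X : topologicalType) (A : topologicalZmodType).

Lemma cech_classP n (u : cech X A n) :
  exists (U : open_cover X) (c : cocycle A U n), u = cech_class c.
Proof. by case: u => m [[U c] mE]; exists U, c; subst m. Qed.

Definition restrict_cocycle (U V : open_cover X)
    (r : cover_index V -> cover_index U) (hr : refines r) n
    (c : cocycle A U n) : cocycle A V n :=
  Cocycle (restrictc_is_cochain hr (@cocycle_is_cochain _ _ _ _ c))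
    (restrictc_closed c hr).

Lemma cech_class_restrict (U V : open_cover X)
    (r : cover_index V -> cover_index U) (hr : refines r) n (c : cocycle A U n) :
  cech_class (restrict_cocycle hr c) = cech_class c.
Proof.
apply/cech_class_onP/Relation_Operators.rst_sym/Relation_Operators.rst_step.
exists r => //=; case: n c => [|n] c.
  by move=> t x _; rewrite /addc /oppc /= subrr.
exists (cochain0 A V n); first exact: cochain0_is_cochain.
by move=> t x tx; rewrite cochain0_closed // /addc /oppc /= subrr.
Qed.

End Representatives.

(** The top cover maps to the pullback of [U] in two ways: by [r \o q], along which the pulled back
    cocycle is a coboundary, and by [s] after [proj_index], which the conclusion demands. The prism
    homotopy between them supplies the correction to [beta]. *)
Lemma cech_pullback0_admissible (X Y : topologicalType)
    (A : topologicalZmodType) (p : Y -> X) (cp : continuous p)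
    (splitp : locally_split p) (u : cech X A 2) :
  cech_pullback cp u = cech0 A 2 ->
  exists (P : admissible_pair p) (a : cocycle A (base_cover P) 2)
    (beta : cochain A (top_cover P) 1),
    [/\ cech_class a = u, is_cochain beta &
      forall t y, cap t y ->
        delta beta t y = cocycle_val a (fun l => proj_index (t l)) (p y)].
Proof.
have [U [c ->]] := cech_classP u; move/cech_pullback_class0P => [V [r [hr cb]]].
have [P [s [q [hs hq]]]] := fine_admissible_pair cp splitp U V.
have hrq : @refines _ (top_cover P) (pullback_cover cp U) (r \o q).
  by move=> j y /hq/hr.
have hsp : @refines _ (top_cover P) (pullback_cover cp U) (s \o @proj_index _ _ _ P).
  by move=> j y /proj_member/hs.
have := is_coboundary_add (coboundary_restrictc hq cb)
  (restrictc_homotopy (pull_cocycle cp c) hrq hsp).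
move=> [beta hbeta betaE].
exists P, (restrict_cocycle hs c), beta; split=> //.
  exact: cech_class_restrict.
move=> t y ty; rewrite -betaE // /addc /oppc /restrictc /= addrC subrK.
by [].
Qed.

(** * The criterion for representability *)

Theorem theorem2p10 (R : realType) (X Y : topologicalType)
    (hX : compactly_generated_hausdorff X)
    (hY : compactly_generated_hausdorff Y)
    (bockX : bockstein_isomorphism R X 2)
    (bockY : bockstein_isomorphism R Y 2)
    (p : Y -> X) (cp : continuous p) (splitp : locally_split p)
    (alpha : cech X Zdisc 3) :
  (exists G : bundle_gerbe R p, is_dixmier_douady G alpha) <->
  cech_pullback cp alpha = cech0 Zdisc 3.

Proof.
split=> [[G [P [sigma [c [beta [a [_ _ _ [hb _ db ba]]]]]]]]|alpha0].
  have a0 : cech_pullback cp (cech_class a) = cech0 (Cstar R) 2.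
    apply/cech_pullback_class0P; exists (top_cover P), (@proj_index _ _ _ P).
    split; first exact: proj_member.
    by exists beta => // t y ty; rewrite db.
  (* The zero class on [Y] is Bockstein-related both to the pullback of [alpha] and to zero; by
     uniqueness of the image these agree. *)
  have := bockstein_pullback cp ba; rewrite a0 => bpa.
  have [v [_ uv]] := bockY.1 (cech0 _ 2).
  by rewrite -(uv _ bpa); apply: uv; exact: bockstein0.
(* Surjectivity on [X] lifts [alpha] to a class [u] with values in C^*; injectivity on [Y] then
   shows that the pullback of [u] vanishes. *)
have [u [bu _]] := bockX.2 alpha.
have := bockstein_pullback cp bu; rewrite alpha0 => bpu.
have [w [_ uw]] := bockY.2 (cech0 _ 3).
have pu0 : cech_pullback cp u = cech0 (Cstar R) 2.
  by rewrite -(uw _ bpu); apply: uw; exact: bockstein0.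
have [P [a [beta [au hb db]]]] := cech_pullback0_admissible splitp pu0.
exists (cochain_gerbe hb db); apply: cochain_gerbe_dixmier_douady.
by rewrite au.
Qed.
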